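(* Let $p$ and $q$ be two distinct primes and let $n=p+q$. Then the prime difference graph $G_n$ contains a Hamilton cycle all of whose edges $uv$ satisfy $|u-v|\in\{p,q\}$.
   Context: For a positive integer $n$, the prime difference graph $G_n$ of order $n$ is the graph with vertex set $\{1,2,\dots,n\}$ in which two vertices $u,v$ are adjacent if and only if $|u-v|$ is a prime number. A Hamilton cycle is a cycle visiting each vertex of the graph exactly once. *)

(* Defs.v *)
From mathcomp Require Import all_boot ssrint.

Set Implicit Arguments.
Unset Strict Implicit.
Unset Printing Implicit Defensive.

(* {1, ..., n}; the integer underlying [u : vertex n] is [ssval u]. *)
Definition vertex (n : nat) : finType := seq_sub (iota 1 n).

(* [`|_ - _|%N] is the distance from ssrint: its minus is the signed one, not
   truncated subtraction. *)
Definition prime_diff_graph (n : nat) : rel (vertex n) :=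
  fun u v => prime `|ssval u - ssval v|%N.

(* A cycle is given by the cyclic sequence of its vertices. For symmetric [e],
   [ucycle e] also accepts the empty sequence and [:: x; y] with [e x y], so
   [2 < size c] is required. *)
Definition hamilton_cycle (T : finType) (e : rel T) (c : seq T) : Prop :=
  [/\ 2 < size c, ucycle e c & forall x : T, x \in c].

(* Membership in [c] is needed because [next c x = x] when [x \notin c]. *)
Definition cycle_edge (T : eqType) (c : seq T) (u v : T) : bool :=
  [&& u \in c, v \in c & (next c u == v) || (next c v == u)].

(* Main.v *)
Require Import Defs.
From mathcomp Require Import all_boot ssrint.
From mathcomp Require Import zify.

(** Read the vertices as the residues modulo [n = p + q] and look at the
    translation by [p]. Since [p] is congruent to [- q] modulo [n], one step of
    the translation either adds [p] or, when it wraps around, subtracts [q]: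
    both change the vertex by a prime amount. Since [p] and [q] are distinct
    primes, [p] is coprime to [n], hence generates the residues modulo [n]: the
    translation has a single orbit, and this orbit is the Hamilton cycle. *)

(** The predecessor and the successor translate between the vertices
    [1, ..., n] and the residues [0, ..., n - 1]. The default [v] of
    [insubd] only makes the definition total: the shifted number always lies in
    [1, ..., n]. *)
Definition shift (n p : nat) (v : vertex n) : vertex n :=
  insubd v (((ssval v).-1 + p) %% n).+1.

Lemma vertex_bounds n (v : vertex n) : 0 < ssval v <= n.
Proof. by have := ssvalP v; rewrite mem_iota; lia. Qed.

Lemma ssval_shift n p (v : vertex n) :
  ssval (shift n p v) = (((ssval v).-1 + p) %% n).+1.
Proof.
have n_gt0 : 0 < n by have := vertex_bounds n v; lia.
by rewrite /shift -[LHS]/(val _) val_insubd mem_iota /= add1n ltnS ltn_pmod.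
Qed.

Lemma shift_inj n p : injective (shift n p).
Proof.
move=> u v /(congr1 (@ssval _ _)); rewrite !ssval_shift => -[] /eqP.
have /andP[u_gt0 u_le] := vertex_bounds n u.
have /andP[v_gt0 v_le] := vertex_bounds n v.
by rewrite eqn_modDr !modn_small ?prednK // => /eqP eq_uv; apply: val_inj => /=; lia.
Qed.

Lemma ssval_iter_shift n p k (v : vertex n) :
  ssval (iter k (shift n p) v) = (((ssval v).-1 + k * p) %% n).+1.
Proof.
elim: k => [|k IHk] /=.
  by have v_bounds := vertex_bounds n v; rewrite addn0 modn_small; lia.
by rewrite ssval_shift IHk /= modnDml mulSn -addnA [k * p + p]addnC.
Qed.

(** By Bezout, some multiple [k * p] is congruent to [1] modulo [n]; to move
    from [u] to [v] it is enough to repeat [k] steps as many times as the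
    difference [v - u], represented by [v + n - u] to stay in [nat]. *)
Lemma fconnect_shift n p (u v : vertex n) :
  0 < p -> coprime p n -> fconnect (shift n p) u v.
Proof.
move=> p_gt0 co_pn.
have /andP[u_gt0 u_le] := vertex_bounds n u.
have /andP[v_gt0 v_le] := vertex_bounds n v.
case: (egcdnP n p_gt0) => k l Ekl _; rewrite (eqP co_pn) in Ekl.
set d := ssval v + n - ssval u.
suff -> : v = iter (d * k) (shift n p) u by apply: fconnect_iter.
apply: val_inj; rewrite -[RHS]/(ssval _) ssval_iter_shift /=.
rewrite -mulnA Ekl mulnDr muln1 mulnA addnCA modnMDl.
have -> : (ssval u).-1 + d = (ssval v).-1 + n by rewrite /d; lia.
by rewrite modnDr modn_small; lia.
Qed.

(** Without wrap-around the step adds [p]; otherwise it adds [p] and removes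
    [p + q], that is, it subtracts [q]. *)
Lemma dist_shift p q (v : vertex (p + q)) : 0 < q ->
  `|ssval v - ssval (shift (p + q) p v)|%N = p \/
  `|ssval v - ssval (shift (p + q) p v)|%N = q.
Proof.
move=> q_gt0; rewrite ssval_shift; have v_bounds := vertex_bounds _ v.
have [no_wrap | wrap] := ltnP ((ssval v).-1 + p) (p + q).
  by left; rewrite modn_small //; lia.
right.
have -> : (ssval v).-1 + p = (ssval v).-1 - q + (p + q) by lia.
by rewrite modnDr modn_small; lia.
Qed.

Theorem proposition4p3 (p q n : nat) (hp : prime p) (hq : prime q)
    (hpq : p <> q) (hn : n = p + q) :
  exists c : seq (vertex n),
    hamilton_cycle (@prime_diff_graph n) c /\
    forall u v : vertex n, cycle_edge c u v ->
      `|ssval u - ssval v|%N = p \/ `|ssval u - ssval v|%N = q.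
Proof.
subst n; set n := p + q.
have p_gt1 := prime_gt1 hp; have q_gt1 := prime_gt1 hq.
have co_pn : coprime p n.
  by rewrite /coprime gcdnDl -/(coprime p q) prime_coprime // dvdn_prime2 //; apply/eqP.
have one_in : 1 \in iota 1 n by rewrite mem_iota; lia.
pose f := shift n p; pose c := orbit f (SeqSub one_in).
have c_cycle : fcycle f c by apply: cycle_orbit; apply: shift_inj.
have c_full v : v \in c.
  by rewrite -fconnect_orbit; apply: fconnect_shift => //; lia.
have dist_f v w : f v == w ->
    `|ssval v - ssval w|%N = p \/ `|ssval v - ssval w|%N = q.
  by move/eqP <-; apply: dist_shift; lia.
exists c; split.
  split=> //.
  - have -> : size c = n.
      rewrite -(card_uniqP (orbit_uniq _ _)) (eq_card (B := predT)) //.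
      by rewrite card_seq_sub ?iota_uniq ?size_iota.
    by rewrite /n; lia.
  - rewrite /ucycle orbit_uniq andbT; apply: sub_cycle c_cycle => v w /dist_f.
    by rewrite /prime_diff_graph => -[] ->.
move=> u v /and3P[_ _ /orP[] /eqP <-].
  exact: dist_f (next_cycle c_cycle (c_full u)).
rewrite distnC.
exact: dist_f (next_cycle c_cycle (c_full v)).
Qed.
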